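(* Let $\Gamma$ be a group. The map $d^\Gamma : \mathrm{Comm}(\Gamma) \to \mathbb{Z}^{(\mathcal{FS})}$ defined by \[ c = [\varphi : A \to B] \mapsto d^\Gamma(c) = \sum_{S \in \mathcal{FS}} \bigl(n_S^\Gamma(B) - n_S^\Gamma(A)\bigr)\,\delta_S , \] where $\varphi : A \to B$ is a $\Gamma$-subnormal representative of $c$, is well-defined and is a group homomorphism.
   Context: A virtual isomorphism of a group $\Gamma$ is an isomorphism $\varphi: A \to B$ between finite index subgroups $A,B$ of $\Gamma$. Two virtual isomorphisms are equivalent if they agree on a common finite index subgroup of their domains; $[\varphi]$ denotes the equivalence class. The composition of $\varphi: A\to B$ followed by $\psi: C \to D$ is the isomorphism $\varphi^{-1}(B\cap C) \to \psi(B\cap C)$, $x \mapsto \psi(\varphi(x))$. Equivalence classes form a group under composition, the abstract commensurator $\mathrm{Comm}(\Gamma)$. A virtual isomorphism $\varphi : A\to B$ is called $\Gamma$-subnormal if both $A$ and $B$ are subnormal subgroups of $\Gamma$; every element of $\mathrm{Comm}(\Gamma)$ has a $\Gamma$-subnormal representative (this is part of well-definedness). $\mathcal{FS}$ is the collection of isomorphism classes of finite simple groups (including cyclic groups of prime order). $\mathbb{Z}^{(\mathcal{FS})}$ is the free abelian group with basis $\mathcal{FS}$, viewed as the group of finitely supported functions $\mathcal{FS}\to\mathbb{Z}$, and $\delta_S$ is the Dirac function at $S$. If $A$ is a finite index subnormal subgroup of $\Gamma$, a composition series going from $A$ to $\Gamma$ is a finite series $(A_\ell,\dots,A_0)$ with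 $A_\ell = A$, $A_0=\Gamma$, each $A_{i+1}$ normal in $A_i$ and $A_i/A_{i+1}$ a finite simple group. For $S \in \mathcal{FS}$, $n_S^\Gamma(A)$ is the number of indices $i$ with $A_i/A_{i+1} \simeq S$; by the Schreier refinement theorem this does not depend on the choice of the composition series. *)

(* Defs.v *)
From HB Require Import structures.
From mathcomp Require Import all_boot all_order all_algebra all_fingroup all_solvable.
From mathcomp Require Import boolp classical_sets functions cardinality.
From mathcomp Require Import freeg.

Set Implicit Arguments.
Unset Strict Implicit.
Unset Printing Implicit Defensive.

Local Open Scope classical_set_scope.
Local Open Scope group_scope.

(* By Cayley's theorem every finite group is isomorphic to a permutation group
   on some 'I_n, so FS, defined as the set of simple permutation groups modulo
   isomorphism, is the set of all isomorphism classes of finite simple groups: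
   see FS_class_unique below.  Working with permutation groups keeps FS in the
   universe of its representatives, so that it can index a free group. *)
Definition simple_perm_group : Type :=
  {G : {n : nat & {group 'S_n}} | simple (tagged G)}.

HB.instance Definition _ := Choice.on simple_perm_group.

Definition fs_isog (G H : simple_perm_group) : bool :=
  tagged (val G) \isog tagged (val H).

Lemma fs_isog_refl : reflexive fs_isog.
Proof. by move=> G; apply: isog_refl. Qed.

Lemma fs_isog_sym : symmetric fs_isog.
Proof. by move=> G H; apply: isog_sym. Qed.

Lemma fs_isog_trans : transitive fs_isog.
Proof. by move=> H G K; apply: isog_trans. Qed.

Canonical fs_isog_equiv :=
  EquivRel fs_isog fs_isog_refl fs_isog_sym fs_isog_trans.

Definition FS : Type := {eq_quot fs_isog}%qT.

HB.instance Definition _ := Choice.on FS.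
HB.instance Definition _ := EqQuotient.on FS.

Definition FS_repr (S : FS) : simple_perm_group := generic_quotient.repr S.

Lemma FS_reprK S : \pi_FS%qT (FS_repr S) = S.
Proof. exact: reprK. Qed.

Lemma FS_piP G H : (\pi_FS G = \pi_FS H)%qT <-> fs_isog G H.
Proof. by split=> [/eqmodP | e]; [|apply/eqmodP]. Qed.

Definition in_class (gT : finGroupType) (G : {group gT}) (S : FS) : bool :=
  G \isog tagged (val (FS_repr S)).

Section Cayley.
Variables (gT : finGroupType).

Definition cayley_fun (x : gT) (i : 'I_#|gT|) : 'I_#|gT| :=
  enum_rank (enum_val i * x).

Lemma cayley_fun_inj x : injective (cayley_fun x).
Proof. by move=> i j /enum_rank_inj /mulIg /enum_val_inj. Qed.

Definition cayley (x : gT) : 'S_#|gT| := perm (@cayley_fun_inj x).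

Lemma cayleyM : {in [set: gT]%SET &, {morph cayley : x y / x * y}}.
Proof.
move=> x y _ _; apply/permP => i; rewrite permM !permE /cayley_fun.
by rewrite enum_rankK mulgA.
Qed.

Canonical cayley_morphism := Morphism cayleyM.

Lemma cayley_isog (G : {group gT}) : G \isog cayley_morphism @* G.
Proof.
apply/sub_isog; first exact: finset.subsetT.
apply/injmP => x y _ _ /= /permP/(_ (enum_rank 1)).
by rewrite !permE /cayley_fun enum_rankK !mul1g => /enum_rank_inj.
Qed.

End Cayley.

Lemma FS_class_unique (gT : finGroupType) (G : {group gT}) :
  simple G -> exists! S : FS, in_class G S.
Proof.
move=> simG; have isoG := cayley_isog G.
have simP : simple (cayley_morphism gT @* G) by rewrite -(isog_simple isoG).
pose P : simple_perm_group :=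
  exist (fun H : {n : nat & {group 'S_n}} => simple (tagged H))
        (Tagged (fun n => {group 'S_n}) (cayley_morphism gT @* G)%G) simP.
have rP (K : simple_perm_group) : fs_isog (FS_repr (\pi_FS K)%qT) K.
  by apply/FS_piP; rewrite FS_reprK.
exists (\pi_FS P)%qT; split=> [|S GS].
  apply: (isog_trans isoG); have := rP P; rewrite fs_isog_sym; exact.
rewrite -[S]FS_reprK; apply/FS_piP.
by apply: isog_trans GS; rewrite isog_sym; exact: isoG.
Qed.

Section Subgroups.
Variable Gam : groupType.
Implicit Types (A B C D H N X Y : set Gam) (x y z : Gam) (S : FS).

Definition subgroup A : Prop :=
  [/\ A 1, forall x y, A x -> A y -> A (x * y) & forall x, A x -> A x^-1].

Definition left_coset x N : set Gam := [set x * y | y in N].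

Definition cosets H N : set (set Gam) := [set left_coset x N | x in H].

Definition finite_index A : Prop := finite_set (cosets setT A).

Definition normal_in N H : Prop :=
  N `<=` H /\ forall x y, H x -> N y -> N (y ^ x).

Definition setprod X Y : set Gam := [set x * y | x in X & y in Y].

(* H / N is isomorphic to G, where N is normal in H: the elements of H / N are
   the cosets of N in H, multiplied as subsets of the ambient group. *)
Definition quotient_isog H N (gT : finGroupType) (G : {group gT}) : Prop :=
  exists f : set Gam -> gT,
    set_bij (cosets H N) [set x | x \in G] f /\
    forall X Y, cosets H N X -> cosets H N Y ->
      f (setprod X Y) = f X * f Y.

Definition quotient_finite_simple H N : Prop :=
  exists (gT : finGroupType) (G : {group gT}), simple G /\ quotient_isog H N G.

(* T 0, ..., T l is a descending series of subgroups going from A = T l to the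
   whole group T 0; the values of T beyond l are irrelevant. *)
Definition is_series (step : set Gam -> set Gam -> Prop) A
    (l : nat) (T : nat -> set Gam) : Prop :=
  [/\ T 0 = setT, T l = A, forall i, i <= l -> subgroup (T i)
    & forall i, i < l -> step (T i) (T i.+1)].

Definition subnormal A : Prop :=
  exists l T, is_series (fun H N => normal_in N H) A l T.

Definition comp_series A (l : nat) (T : nat -> set Gam) : Prop :=
  is_series (fun H N => normal_in N H /\ quotient_finite_simple H N) A l T.

Definition factor_class H N S : Prop :=
  quotient_isog H N (tagged (val (FS_repr S))).

Definition nb_factors S (l : nat) (T : nat -> set Gam) : nat :=
  #|[set i : 'I_l | `[< factor_class (T i) (T i.+1) S >]]%SET|.

(* The number of factors of class S in some composition series from A to the
   whole group, and 0 if A has no such series. *)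
Definition n_ S A : nat :=
  xget 0 [set k | exists l T, comp_series A l T /\ k = nb_factors S l T].

Lemma finite_indexP A : subgroup A ->
  finite_index A <->
  exists (T : finType) (f : Gam -> T), forall x y, f x = f y -> A (x^-1 * y).
Proof.
move=> [A1 AM AV]; split=> [|[T [f fP]]].
  move=> /finite_seqP[s sE].
  have ltx x : (index (left_coset x A) s < (size s).+1)%N.
    by rewrite ltnS index_size.
  exists 'I_(size s).+1, (fun x => Ordinal (ltx x)) => x y [] eqi.
  have ins z : left_coset z A \in s.
    by have : cosets setT A (left_coset z A); [exists z | rewrite sE].
  have eqc : left_coset x A = left_coset y A.
    by rewrite -(nth_index set0 (ins x)) eqi nth_index.
  have : left_coset y A y by exists 1; rewrite ?mulg1.
  by rewrite -eqc => -[a Aa <-]; rewrite mulKg.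
have : finite_set [set left_coset (xget 1 [set x | f x = t]) A | t in [set: T]].
  exact/finite_image/finite_finset.
apply: sub_finite_set => _ [x _ <-]; exists (f x) => //.
have /= fx : [set z | f z = f x] (xget 1 [set z | f z = f x]).
  by apply: (@xgetI _ _ _ x).
move: (xget _ _) fx => z fz; have zx := fP _ _ fz.
apply/seteqP; split=> _ [a Aa <-]; rewrite /left_coset /=.
  exists (x^-1 * z * a); last by rewrite mulgA mulVKg.
  by apply: AM => //; rewrite -[x^-1 * z]invgK invgM invgK; apply: AV.
exists (z^-1 * x * a); last by rewrite mulgA mulVKg.
exact: AM.
Qed.

Lemma subgroupT : subgroup setT.
Proof. by []. Qed.

Lemma finite_indexT : finite_index setT.
Proof. by apply/(finite_indexP subgroupT); exists unit, (fun=> tt). Qed.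

Lemma subgroupI A B : subgroup A -> subgroup B -> subgroup (A `&` B).
Proof.
move=> [A1 AM AV] [B1 BM BV]; split=> //.
- by move=> x y [? ?] [? ?]; split; [apply: AM | apply: BM].
- by move=> x [? ?]; split; [apply: AV | apply: BV].
Qed.

Lemma finite_indexI A B : subgroup A -> subgroup B ->
  finite_index A -> finite_index B -> finite_index (A `&` B).
Proof.
move=> sA sB /(finite_indexP sA)[T [f fP]] /(finite_indexP sB)[U [g gP]].
apply/(finite_indexP (subgroupI sA sB)).
exists (T * U)%type, (fun x => (f x, g x)) => x y [] ? ?.
by split; [apply: fP | apply: gP].
Qed.

Lemma subgroup_preim A D (f : Gam -> Gam) : subgroup A -> subgroup D ->
    (forall x y, A x -> A y -> f (x * y) = f x * f y) ->
  subgroup [set x | A x /\ D (f x)].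
Proof.
move=> [A1 AM AV] [D1 DM DV] fM.
have f1 : f 1 = 1 by apply: (@mulgI _ (f 1)); rewrite -fM // !mulg1.
have fV x : A x -> f x^-1 = (f x)^-1.
  move=> Ax; apply: (@mulgI _ (f x)); rewrite -fM //; last exact: AV.
  by rewrite !mulgV.
split; first by rewrite /= f1.
  by move=> x y [Ax Dx] [Ay Dy]; rewrite /= fM //; split; [apply: AM | apply: DM].
by move=> x [Ax Dx]; rewrite /= fV //; split; [apply: AV | apply: DV].
Qed.

Lemma finite_index_preim A D (f : Gam -> Gam) : subgroup A -> subgroup D ->
    (forall x y, A x -> A y -> f (x * y) = f x * f y) ->
    finite_index A -> finite_index D ->
  finite_index [set x | A x /\ D (f x)].
Proof.
move=> sA sD fM /(finite_indexP sA)[T [g gP]] /(finite_indexP sD)[U [h hP]].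
apply/(finite_indexP (subgroup_preim sA sD fM)).
pose r x := xget 1 [set z | g z = g x].
have rP x : A ((r x)^-1 * x).
  by apply: gP; apply: (@xgetI _ _ [set z | g z = g x] x).
exists (T * U)%type, (fun x => (g x, h (f ((r x)^-1 * x)))) => x y [] gxy.
have -> : r y = r x by rewrite /r gxy.
have ry : A ((r x)^-1 * y) by have := rP y; rewrite /r -gxy.
have Axy := gP _ _ gxy; move=> /hP Dxy; split=> //.
have fE : f ((r x)^-1 * y) = f ((r x)^-1 * x) * f (x^-1 * y).
  by rewrite -fM // mulgA mulgK.
by move: Dxy; rewrite fE mulKg.
Qed.

End Subgroups.

Section Commensurator.
Variable Gam : groupType.
Implicit Types (A B C D : set Gam) (x y z : Gam).

(* Only the restriction of vfun to vdom is meaningful. *)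
Record virt_iso := VirtIso {
  vdom : set Gam;
  vcod : set Gam;
  vfun :> Gam -> Gam;
  vdom_subgroup : subgroup vdom;
  vcod_subgroup : subgroup vcod;
  vdom_finite_index : finite_index vdom;
  vcod_finite_index : finite_index vcod;
  vfun_bij : set_bij vdom vcod vfun;
  vfunM : forall x y, vdom x -> vdom y -> vfun (x * y) = vfun x * vfun y
}.

HB.instance Definition _ := gen_eqMixin virt_iso.
HB.instance Definition _ := gen_choiceMixin virt_iso.

Implicit Types phi psi chi : virt_iso.

Definition subnormal_iso phi : Prop :=
  subnormal (vdom phi) /\ subnormal (vcod phi).

Definition virt_eq phi psi : Prop :=
  exists C, [/\ subgroup C, finite_index C, C `<=` vdom phi `&` vdom psi
              & forall x, C x -> phi x = psi x].

Definition virt_eqb phi psi : bool := `[< virt_eq phi psi >].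

Lemma virt_eqb_refl : reflexive virt_eqb.
Proof.
move=> phi; apply/asboolP; exists (vdom phi); split=> //.
- exact: vdom_subgroup.
- exact: vdom_finite_index.
Qed.

Lemma virt_eqb_sym : symmetric virt_eqb.
Proof.
by move=> phi psi; apply/asboolP/asboolP => -[C [? ? sub eqC]]; exists C;
  split=> // x Cx; [have [] := sub x Cx | rewrite eqC
                   |have [] := sub x Cx | rewrite eqC].
Qed.

Lemma virt_eqb_trans : transitive virt_eqb.
Proof.
move=> psi phi chi /asboolP[C [sC fC subC eqC]] /asboolP[D [sD fD subD eqD]].
apply/asboolP; exists (C `&` D); split.
- exact: subgroupI.
- exact: finite_indexI.
- by move=> x [/subC[? ?] /subD[? ?]].
- by move=> x [Cx Dx]; rewrite eqC // eqD.
Qed.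

Canonical virt_eqb_equiv :=
  EquivRel virt_eqb virt_eqb_refl virt_eqb_sym virt_eqb_trans.

Definition Comm : Type := {eq_quot virt_eqb}%qT.

HB.instance Definition _ := Choice.on Comm.
HB.instance Definition _ := EqQuotient.on Comm.

Definition Comm_repr (c : Comm) : virt_iso := generic_quotient.repr c.

Definition Comm_class phi : Comm := (\pi_Comm phi)%qT.

Lemma Comm_classP phi psi :
  Comm_class phi = Comm_class psi <-> virt_eq phi psi.
Proof.
by split=> [/eqmodP/asboolP // | e]; apply/eqmodP/asboolP.
Qed.

Lemma Comm_class_repr (c : Comm) : Comm_class (Comm_repr c) = c.
Proof. exact: reprK. Qed.

Lemma vfun_cod phi x : vdom phi x -> vcod phi (phi x).
Proof. by have [fAB _ _] := vfun_bij phi; apply: fAB. Qed.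

Lemma vfun_inj phi x y : vdom phi x -> vdom phi y -> phi x = phi y -> x = y.
Proof. by have [_ inj _] := vfun_bij phi => ? ?; apply: inj; rewrite inE. Qed.

Lemma vfun_surj phi y : vcod phi y -> exists2 x, vdom phi x & phi x = y.
Proof. by have [_ _ surj] := vfun_bij phi => /surj[x]; exists x. Qed.

Lemma vid_bij : set_bij [set: Gam] [set: Gam] id.
Proof. by split=> // x _; exists x. Qed.

Definition vid : virt_iso :=
  @VirtIso setT setT id (subgroupT Gam) (subgroupT Gam)
    (finite_indexT Gam) (finite_indexT Gam) vid_bij (fun _ _ _ _ => erefl).

Definition vinv_fun phi y : Gam := xget 1 [set x | vdom phi x /\ phi x = y].

Lemma vinv_funP phi y : vcod phi y ->
  vdom phi (vinv_fun phi y) /\ phi (vinv_fun phi y) = y.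
Proof.
move=> /vfun_surj[x Ax fx].
exact: (@xgetI _ 1 [set x | vdom phi x /\ phi x = y] x).
Qed.

Lemma vinv_funK phi x : vdom phi x -> vinv_fun phi (phi x) = x.
Proof.
by move=> Ax; have [? ?] := vinv_funP (vfun_cod Ax); apply: (@vfun_inj phi).
Qed.

Lemma vinv_bij phi : set_bij (vcod phi) (vdom phi) (vinv_fun phi).
Proof.
split.
- by move=> y /vinv_funP[].
- move=> y z /set_mem By /set_mem Bz e.
  by rewrite -(vinv_funP By).2 e (vinv_funP Bz).2.
- by move=> x Ax; exists (phi x); [apply: vfun_cod | apply: vinv_funK].
Qed.

Lemma vinvM phi x y : vcod phi x -> vcod phi y ->
  vinv_fun phi (x * y) = vinv_fun phi x * vinv_fun phi y.
Proof.
move=> /vinv_funP[Ax Ex] /vinv_funP[Ay Ey].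
rewrite -{1}Ex -{1}Ey -vfunM // vinv_funK //.
by case: (vdom_subgroup phi) => _ AM _; apply: AM.
Qed.

Definition vinv phi : virt_iso :=
  VirtIso (vcod_subgroup phi) (vdom_subgroup phi) (vcod_finite_index phi)
    (vdom_finite_index phi) (vinv_bij phi) (@vinvM phi).

Lemma vpreim_subgroup phi D : subgroup D ->
  subgroup [set x | vdom phi x /\ D (phi x)].
Proof.
by move=> sD; apply: subgroup_preim => //;
  [apply: vdom_subgroup | apply: vfunM].
Qed.

Lemma vpreim_finite_index phi D : subgroup D -> finite_index D ->
  finite_index [set x | vdom phi x /\ D (phi x)].
Proof.
move=> sD fD; apply: finite_index_preim => //;
  [exact: vdom_subgroup | exact: vfunM | exact: vdom_finite_index].
Qed.

Lemma vimageE phi D : D `<=` vdom phi ->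
  [set phi x | x in D] = [set y | vdom (vinv phi) y /\ D (vinv phi y)].
Proof.
move=> DA; apply/seteqP; split=> [_ [x Dx <-] | y [By Dy]] /=.
  by rewrite vinv_funK; [split=> //; apply/vfun_cod/DA | apply: DA].
by exists (vinv_fun phi y) => //; apply: (vinv_funP By).2.
Qed.

(* phi : A -> B followed by psi : C -> D *)
Section Composition.
Variables phi psi : virt_iso.
Let B := vcod phi.
Let C := vdom psi.

Definition vcomp_dom : set Gam := [set x | vdom phi x /\ (B `&` C) (phi x)].
Definition vcomp_cod : set Gam := [set psi y | y in B `&` C].

Let sBC : subgroup (B `&` C).
Proof. by apply: subgroupI; [apply: vcod_subgroup | apply: vdom_subgroup]. Qed.

Let fBC : finite_index (B `&` C).
Proof.
by apply: finite_indexI; [apply: vcod_subgroup | apply: vdom_subgroup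
  | apply: vcod_finite_index | apply: vdom_finite_index].
Qed.

Lemma vcomp_dom_subgroup : subgroup vcomp_dom.
Proof. exact: vpreim_subgroup. Qed.

Lemma vcomp_dom_finite_index : finite_index vcomp_dom.
Proof. exact: vpreim_finite_index. Qed.

Lemma vcomp_cod_subgroup : subgroup vcomp_cod.
Proof.
by rewrite /vcomp_cod vimageE; [apply: vpreim_subgroup | move=> x []].
Qed.

Lemma vcomp_cod_finite_index : finite_index vcomp_cod.
Proof.
by rewrite /vcomp_cod vimageE; [apply: vpreim_finite_index | move=> x []].
Qed.

Lemma vcomp_bij : set_bij vcomp_dom vcomp_cod (fun x => psi (phi x)).
Proof.
split.
- by move=> x [Ax BCx]; exists (phi x).
- move=> x y /set_mem[Ax [_ Cx]] /set_mem[Ay [_ Cy]] /vfun_inj.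
  by move=> /(_ Cx Cy) /vfun_inj; apply.
- move=> _ [y [By Cy] <-]; have [x Ax fx] := vfun_surj By.
  by exists x; rewrite /vcomp_dom /= fx.
Qed.

Lemma vcompM x y : vcomp_dom x -> vcomp_dom y ->
  psi (phi (x * y)) = psi (phi x) * psi (phi y).
Proof. by move=> [Ax [_ Cx]] [Ay [_ Cy]]; rewrite vfunM // vfunM. Qed.

Definition vcomp : virt_iso :=
  VirtIso vcomp_dom_subgroup vcomp_cod_subgroup vcomp_dom_finite_index
    vcomp_cod_finite_index vcomp_bij vcompM.

End Composition.

Lemma vcomp_virt_eq phi phi' psi psi' :
  virt_eq phi phi' -> virt_eq psi psi' ->
  virt_eq (vcomp phi psi) (vcomp phi' psi').
Proof.
move=> [C [sC fC subC eqC]] [D [sD fD subD eqD]].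
exists (C `&` [set x | vdom phi x /\ D (phi x)]); split.
- by apply: subgroupI => //; apply: vpreim_subgroup.
- apply: finite_indexI => //; first exact: vpreim_subgroup.
  exact: vpreim_finite_index.
- move=> x [Cx [Ax Dx]]; have [_ A'x] := subC x Cx.
  have [? ?] := subD _ Dx; split; split=> //; split=> //; first exact: vfun_cod.
    exact: vfun_cod.
  by rewrite -eqC.
- by move=> x [Cx [Ax Dx]] /=; rewrite eqD // eqC.
Qed.

(* The product is the composition of maps: the right factor is applied first. *)
Definition Comm_mul (c d : Comm) : Comm := Comm_class (vcomp (Comm_repr d) (Comm_repr c)).
Definition Comm_one : Comm := Comm_class vid.
Definition Comm_inv (c : Comm) : Comm := Comm_class (vinv (Comm_repr c)).

Lemma Comm_mulE phi psi :
  Comm_mul (Comm_class psi) (Comm_class phi) = Comm_class (vcomp phi psi).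
Proof.
by apply/Comm_classP/vcomp_virt_eq; apply/Comm_classP; rewrite Comm_class_repr.
Qed.

Lemma Comm_mulA : associative Comm_mul.
Proof.
move=> c d e; rewrite -[c]Comm_class_repr -[d]Comm_class_repr.
rewrite -[e]Comm_class_repr !Comm_mulE; move: (Comm_repr c) (Comm_repr d) (Comm_repr e).
move=> chi psi phi; apply/Comm_classP.
exists (vdom (vcomp phi (vcomp psi chi))); split=> //.
- exact: vdom_subgroup.
- exact: vdom_finite_index.
- move=> x [Ax [Bx [Cx [Dx Ex]]]]; split=> //; split=> //; split=> //.
  by exists (phi x).
Qed.

Lemma Comm_mul1g : left_id Comm_one Comm_mul.
Proof.
move=> c; rewrite -[c]Comm_class_repr Comm_mulE; apply/Comm_classP.
exists (vdom (Comm_repr c)); split=> //.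
- exact: vdom_subgroup.
- exact: vdom_finite_index.
- by move=> x Ax; split=> //; split=> //; split=> //; apply: vfun_cod.
Qed.

Lemma Comm_mulg1 : right_id Comm_one Comm_mul.
Proof.
move=> c; rewrite -[c]Comm_class_repr Comm_mulE; apply/Comm_classP.
exists (vdom (Comm_repr c)); split=> //.
- exact: vdom_subgroup.
- exact: vdom_finite_index.
Qed.

Lemma Comm_mulVg : left_inverse Comm_one Comm_inv Comm_mul.
Proof.
move=> c; rewrite -{2}[c]Comm_class_repr Comm_mulE; apply/Comm_classP.
exists (vdom (Comm_repr c)); split=> //.
- exact: vdom_subgroup.
- exact: vdom_finite_index.
- by move=> x Ax; split=> //; split=> //; split; apply: vfun_cod.
- by move=> x Ax /=; apply: vinv_funK.
Qed.

Lemma Comm_mulgV : right_inverse Comm_one Comm_inv Comm_mul.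
Proof.
move=> c; rewrite -{1}[c]Comm_class_repr Comm_mulE; apply/Comm_classP.
exists (vcod (Comm_repr c)); split=> //.
- exact: vcod_subgroup.
- exact: vcod_finite_index.
- by move=> y By; have [? ?] := vinv_funP By; split=> //; split=> //; split.
- by move=> y By /=; apply: (vinv_funP By).2.
Qed.

HB.instance Definition _ := isGroup.Build Comm
  Comm_mulA Comm_mul1g Comm_mulg1 Comm_mulVg Comm_mulgV.

End Commensurator.

(* Main.v *)
(* Required before the definitions: it also has a constant named subnormal,
   for finite groups, which must not hide the one defined there. *)
From mathcomp Require Import all_solvable.
Require Import Defs.
From mathcomp Require Import all_boot all_order all_algebra all_fingroup.
From mathcomp Require Import boolp classical_sets functions.
From mathcomp Require Import freeg.

(** The value of d at the class of phi : A -> B is the difference of the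
    composition factors between B and Gam and those between A and Gam. It only
    depends on the class because passing to a smaller subgroup C of A adds the
    same factors on both sides: by the Jordan-Hoelder theorem the factors from C
    to Gam are those from C to A together with those from A to Gam, the same
    holds for phi(C) and B, and phi carries a composition series from C to A to
    one from phi(C) to B with isomorphic factors. Hence n(B) - n(A) is equal to
    n(phi(C)) - n(C) for every subnormal C of finite index in A (n_diff_restrict).

    - Well-definedness (n_diff_virt_eq): if phi and psi agree on C, they agree on
      the normal core K of C, which is subnormal with the same image under both,
      so both differences are n(phi(K)) - n(K).
    - Subnormal representatives (subnormal_repr): if L is the core of B and K the
      core of the preimage of L, then phi(K) is normal in L and L in Gam, so the
      restriction of phi to K has subnormal domain and codomain.
    - Additivity (n_diff_vcomp): for phi : A -> B and psi : C -> D, put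
      E = B :&: C. Both differences can be computed on E, that of phi from the
      preimage of E to E, that of psi from E to psi(E); their sum telescopes to
      the difference of the composite map.

    The Jordan-Hoelder theorem (comp_chain_perm) is proved for subgroups of the
    infinite group Gam by the classical induction: if a group H has two distinct
    maximal normal subgroups N and K with simple quotients, then N / (N :&: K) is
    isomorphic to H / K and K / (N :&: K) to H / N, and both series are compared
    with series through N :&: K. Composition series exist (comp_chain_exists)
    because each quotient in a subnormal series of finite index is a finite
    group, whose maximal normal subgroups can be pulled back. *)

Set Implicit Arguments.
Unset Strict Implicit.
Unset Printing Implicit Defensive.

(** * Quotients as homomorphisms onto finite groups *)

Section FiniteQuotients.
Local Open Scope classical_set_scope.
Local Open Scope group_scope.

Variable Gam : groupType.
Implicit Types (A B C H K M N : set Gam) (x y z : Gam) (S : FS).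

Lemma subgroup_mulV H x y : subgroup H -> H x -> H y -> H (x * y^-1).
Proof. by move=> [_ HM HV] Hx Hy; apply: HM => //; apply: HV. Qed.

Lemma subgroup_conj H x y : subgroup H -> H x -> H y -> H (x ^ y).
Proof. by move=> [_ HM HV] Hx Hy; exact: HM (HV _ Hy) (HM _ _ Hx Hy). Qed.

(** g induces an isomorphism from H / N to G. Homomorphisms, unlike sets of
    cosets, are easy to restrict, to compose and to transport. *)
Record quotient_map H N (gT : finGroupType) (G : {group gT}) (g : Gam -> gT)
    : Prop := QuotientMap {
  qmap_sub : subgroup H;
  qmap_le : N `<=` H;
  qmapM : forall x y, H x -> H y -> g (x * y) = g x * g y;
  qmap_im : forall t, t \in G <-> exists2 x, H x & g x = t;
  qmap_ker : forall x, H x -> g x = 1 <-> N x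
}.

Lemma hom1 H (gT : finGroupType) (g : Gam -> gT) : subgroup H ->
  (forall x y, H x -> H y -> g (x * y) = g x * g y) -> g 1 = 1.
Proof. by move=> [H1 _ _] gM; apply: (@mulgI _ (g 1)); rewrite -gM // !mulg1. Qed.

Lemma homV H (gT : finGroupType) (g : Gam -> gT) : subgroup H ->
  (forall x y, H x -> H y -> g (x * y) = g x * g y) ->
  forall x, H x -> g x^-1 = (g x)^-1.
Proof.
move=> sH gM x Hx; apply: (@mulgI _ (g x)); rewrite -gM //.
  by rewrite !mulgV (hom1 sH gM).
by case: sH => _ _; apply.
Qed.

Lemma homJ H (gT : finGroupType) (g : Gam -> gT) : subgroup H ->
    (forall x y, H x -> H y -> g (x * y) = g x * g y) ->
  forall x y, H x -> H y -> g (x ^ y) = g x ^ g y.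
Proof.
move=> sH gM x y Hx Hy; have [_ HM HV] := sH.
have [Vy xy] := (HV _ Hy, HM _ _ Hx Hy).
by rewrite !conjgE !gM // (homV sH gM).
Qed.

Lemma hom_image_group H (gT : finGroupType) (g : Gam -> gT) : subgroup H ->
    (forall x y, H x -> H y -> g (x * y) = g x * g y) ->
  exists G : {group gT}, forall t, t \in G <-> exists2 x, H x & g x = t.
Proof.
move=> sH gM; have [H1 HM _] := sH.
pose I := [set t | `[< exists2 x, H x & g x = t >]]%SET.
have gI : group_set I.
  apply/group_setP; split=> [|t u].
    by rewrite !inE; exists 1 => //; apply: hom1 sH gM.
  rewrite !inE => -[x Hx <-] [y Hy <-].
  by exists (x * y); [apply: HM | rewrite gM].
by exists (Group gI) => t; rewrite !inE.
Qed.

Section Quotient.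
Variables (H N : set Gam) (gT : finGroupType) (G : {group gT}) (g : Gam -> gT).
Hypothesis gP : quotient_map H N G g.

Let sH := qmap_sub gP.
Let gM := qmapM gP.

Lemma qmap_in x : H x -> g x \in G.
Proof. by move=> Hx; apply/(qmap_im gP); exists x. Qed.

Lemma qmap_eq x y : H x -> H y -> g x = g y <-> N (x * y^-1).
Proof.
move=> Hx Hy; rewrite -(qmap_ker gP); last exact: subgroup_mulV.
rewrite gM //; last by case: sH => _ _; apply.
rewrite (homV sH gM) //; split=> [-> | /(canRL (mulgKV _))]; first by rewrite mulgV.
by rewrite mul1g.
Qed.

Lemma qmap_ker_subgroup : subgroup N.
Proof.
have [H1 HM HV] := sH; split.
- by apply/(qmap_ker gP) => //; apply: hom1 sH gM.
- move=> x y Nx Ny; have [Hx Hy] := (qmap_le gP Nx, qmap_le gP Ny).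
  apply/(qmap_ker gP); first exact: HM.
  by rewrite gM // (qmap_ker gP Hx).2 // (qmap_ker gP Hy).2 ?mulg1.
- move=> x Nx; have Hx := qmap_le gP Nx; apply/(qmap_ker gP); first exact: HV.
  by rewrite (homV sH gM) // (qmap_ker gP Hx).2 ?invg1.
Qed.

Lemma qmap_ker_normal : normal_in N H.
Proof.
split; first exact: qmap_le gP.
move=> x y Hx Ny; have Hy := qmap_le gP Ny; have [_ HM HV] := sH.
apply/(qmap_ker gP); first exact: subgroup_conj.
by rewrite (homJ sH gM) // (qmap_ker gP Hy).2 // conj1g.
Qed.

(** The image of K in the simple group G is normal, so it is trivial or G. *)
Lemma qmap_image_simple K : simple G -> subgroup K -> normal_in K H ->
  K `<=` N \/ forall t, t \in G -> exists2 x, K x & g x = t.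
Proof.
move=> /simpleP[_ simG] sK [KH nK].
have [|I IP] := @hom_image_group K gT g sK.
  by move=> x y /KH Hx /KH Hy; apply: gM.
have : I <| G.
  apply/andP; split.
    by apply/fintype.subsetP => _ /IP[x Kx <-]; apply/qmap_in/KH.
  apply/fintype.subsetP => t /(qmap_im gP)[x Hx <-]; rewrite inE.
  apply/fintype.subsetP => _ /imsetP[_ /IP[y Ky <-] ->]; apply/IP.
  exists (y ^ x); first exact: nK.
  by rewrite (homJ sH gM) //; apply: KH.
case/simG => IE; [left | by right=> t; rewrite -IE => /IP].
move=> x Kx; apply/(qmap_ker gP); first exact: KH.
by apply/set1gP; have : g x \in I; [apply/IP; exists x | rewrite IE].
Qed.

End Quotient.

Lemma left_coset_eq N x y : subgroup N ->
  left_coset x N = left_coset y N <-> N (x^-1 * y).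
Proof.
move=> [N1 NM NV]; split=> [e | Nxy].
  have : left_coset y N y by exists 1; rewrite ?mulg1.
  by rewrite -e => -[a Na <-]; rewrite mulKg.
apply/seteqP; split=> _ [a Na <-].
  exists ((x^-1 * y)^-1 * a); first by apply: NM => //; apply: NV.
  by rewrite invgM invgK mulgA mulVKg.
by exists (x^-1 * y * a); [apply: NM | rewrite mulgA mulVKg].
Qed.

Lemma setprod_left_coset H N x y : subgroup N -> normal_in N H -> H y ->
  setprod (left_coset x N) (left_coset y N) = left_coset (x * y) N.
Proof.
move=> [N1 NM NV] [_ nN] Hy; apply/seteqP; split.
  move=> _ [_ [a Na <-]] [_ [b Nb <-] <-].
  exists (a ^ y * b); first by apply: NM => //; apply: nN.
  by rewrite conjgE !mulgA mulgK.
move=> _ [a Na <-]; exists (x * 1); first by exists 1.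
by exists (y * a); [exists a | rewrite mulg1 mulgA].
Qed.

(** A bijection f on cosets gives the homomorphism x |-> f (x N); conversely a
    homomorphism is constant on cosets, so it can be evaluated at any element
    of the coset. *)
Lemma quotient_isogP H N (gT : finGroupType) (G : {group gT}) :
    subgroup H -> subgroup N -> normal_in N H ->
  Defs.quotient_isog H N G <-> exists g : Gam -> gT, quotient_map H N G g.
Proof.
move=> sH sN nN; have [NH _] := nN; split=> [[f [[fin finj fsurj] fM]] | [g gP]].
  have inC x : H x -> cosets H N (left_coset x N) by move=> Hx; exists x.
  pose g x := f (left_coset x N).
  have gM x y : H x -> H y -> g (x * y) = g x * g y.
    by move=> Hx Hy; rewrite -fM; [|exact: inC..]; rewrite (setprod_left_coset _ sN nN).
  exists g; split=> //.
    move=> t; split=> [Gt | [x Hx <-]]; last exact/fin/inC.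
    by have [_ [x Hx <-] <-] := fsurj t Gt; exists x.
  move=> x Hx; rewrite -(hom1 sH gM); have [H1 _ _] := sH.
  split=> [e | Nx].
    have := finj _ _ (mem_set (inC _ H1)) (mem_set (inC _ Hx)) (esym e).
    by move/(left_coset_eq _ _ sN); rewrite invg1 mul1g.
  congr f; apply/esym/(left_coset_eq _ _ sN).
  by rewrite invg1 mul1g.
have [_ HM _] := sH; have sub1 := qmap_sub gP.
pose f (X : set Gam) := g (xget 1 X).
have fE x : H x -> f (left_coset x N) = g x.
  move=> Hx; rewrite /f; have : left_coset x N x by exists 1; rewrite ?mulg1; case: sN.
  move=> /(@xgetI _ 1 _ x)[a Na <-]; have Ha := NH _ Na.
  by rewrite (qmapM gP) // (qmap_ker gP Ha).2 // mulg1.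
exists f; split; first split.
- by move=> _ [x Hx <-]; rewrite fE //; exact: qmap_in gP _ Hx.
- move=> _ _ /set_mem[x Hx <-] /set_mem[y Hy <-]; rewrite !fE // => e.
  apply/(left_coset_eq _ _ sN); apply/(qmap_ker gP).
    by apply: HM => //; case: sH => _ _; apply.
  rewrite (qmapM gP) // ?(homV sH (qmapM gP)) // ?e ?mulVg //.
  by case: sH => _ _; apply.
- by move=> t /(qmap_im gP)[x Hx <-]; exists (left_coset x N); [exists x | rewrite fE].
- move=> _ _ [x Hx <-] [y Hy <-]; rewrite (setprod_left_coset _ sN nN) //.
  by rewrite !fE ?(qmapM gP) //; apply: HM.
Qed.

(** The isomorphism sends g x to h x; it exists because g and h have the same
    fibres on H, the cosets of N. *)
Lemma qmap_unique H N (gT hT : finGroupType) (G : {group gT}) (K : {group hT}) g h :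
  quotient_map H N G g -> quotient_map H N K h -> G \isog K.
Proof.
move=> gP hP; have sH := qmap_sub gP; have [H1 HM HV] := sH.
pose r t := xget 1 [set x | H x /\ g x = t].
have rP t : t \in G -> H (r t) /\ g (r t) = t.
  by move=> /(qmap_im gP)[x Hx gx]; apply: (@xgetI _ 1 [set x | H x /\ g x = t] x).
pose f t := h (r t).
have fE x : H x -> f (g x) = h x.
  move=> Hx; have [Hr gr] := rP _ (qmap_in gP Hx).
  by apply/(qmap_eq hP) => //; apply/(qmap_eq gP).
have fM : {in G &, {morph f : x y / x * y}}.
  move=> _ _ /(qmap_im gP)[x Hx <-] /(qmap_im gP)[y Hy <-].
  by rewrite -(qmapM gP) // !fE ?(qmapM hP) //; apply: HM.
apply/isogP; exists (Morphism fM).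
  apply/injmP => _ _ /(qmap_im gP)[x Hx <-] /(qmap_im gP)[y Hy <-] /=.
  by rewrite !fE // => /(qmap_eq hP Hx Hy)/(qmap_eq gP Hx Hy).
apply/setP => t; apply/idP/idP.
  case/morphimP => _ _ /(qmap_im gP)[x Hx <-] -> /=; rewrite fE //.
  exact: qmap_in hP _ Hx.
move=> /(qmap_im hP)[x Hx <-]; rewrite -fE //.
by apply: (mem_morphim (Morphism fM)); apply: qmap_in gP _ Hx.
Qed.

Lemma qmap_isog H N (gT hT : finGroupType) (G : {group gT}) (K : {group hT}) g :
    quotient_map H N G g -> G \isog K ->
  exists h, quotient_map H N K h.
Proof.
move=> gP /isogP[f /injmP injf fG]; exists (f \o g).
split; first exact: qmap_sub gP.
- exact: qmap_le gP.
- move=> x y Hx Hy /=; rewrite (qmapM gP) // morphM //; exact: qmap_in gP _ _.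
- move=> t; rewrite -fG; split=> [/morphimP[_ _ /(qmap_im gP)[x Hx <-] ->] | [x Hx <-]].
    by exists x.
  by apply: mem_morphim; exact: qmap_in gP _ Hx.
- move=> x Hx; rewrite -(qmap_ker gP) //=; split=> [| ->]; last exact: morph1.
  by rewrite -(morph1 f); apply: injf; rewrite ?group1 //; exact: qmap_in gP _ Hx.
Qed.

(** The second isomorphism theorem for N K = H. That h is already onto on N holds
    because otherwise N is contained in K; as g K is trivial or G, then either K
    is contained in N, so that N = K, or K is H, so that L is trivial, and both
    are excluded. *)
Lemma qmap_capl H N K (gT hT : finGroupType) (G : {group gT}) (L : {group hT}) g h :
    quotient_map H N G g -> quotient_map H K L h -> simple G -> simple L ->
    N <> K ->
  quotient_map N (N `&` K) L h.
Proof.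
move=> gP hP simG simL neNK.
have [sN sK] := (qmap_ker_subgroup gP, qmap_ker_subgroup hP).
have [nN nK] := (qmap_ker_normal gP, qmap_ker_normal hP).
have NH := qmap_le gP.
have hN t : t \in L -> exists2 x, N x & h x = t.
  have [NK | ] := qmap_image_simple hP simL sN nN; last exact.
  have [KN | gK] := qmap_image_simple gP simG sK nK.
    by case: neNK; apply/seteqP.
  have HK : H `<=` K.
    move=> x Hx; have [y Ky] := gK _ (qmap_in gP Hx).
    move=> /esym/(qmap_eq gP Hx (qmap_le hP Ky))/NK.
    by move=> Kxy; rewrite -(mulgKV y x); case: sK => _ KM _; apply: KM.
  move: simL => /simpleP[/eqP[]]; apply/trivgP/fintype.subsetP => u.
  move=> /(qmap_im hP)[x Hx <-]; apply/set1gP/(qmap_ker hP) => //; exact: HK.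
split=> [|x|x y Nx Ny|t|x Nx].
- by [].
- by case.
- by apply: (qmapM hP); apply: NH.
- by split=> [/hN // | [x /NH Hx <-]]; exact: qmap_in hP _ Hx.
- rewrite (qmap_ker hP); last exact: NH.
  by split=> [Kx | []].
Qed.

End FiniteQuotients.

(** * Subgroups of finite index *)

Section FiniteIndex.
Local Open Scope classical_set_scope.
Local Open Scope group_scope.

Variable Gam : groupType.
Implicit Types (A B C H K M N : set Gam) (x y z : Gam) (S : FS).

Lemma finite_index_le A H : subgroup A -> subgroup H -> A `<=` H ->
  finite_index A -> finite_index H.
Proof.
move=> sA sH AH /(finite_indexP sA)[T [f fP]]; apply/(finite_indexP sH).
by exists T, f => x y /fP/AH.
Qed.

Lemma finite_index_cosets A : subgroup A -> finite_index A ->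
  exists (T : finType) (f : Gam -> T) (r : T -> Gam),
    cancel r f /\ forall x y, f x = f y <-> A (x^-1 * y).
Proof.
move=> sA /(finite_indexP sA)[T0 [f0 f0P]].
have [A1 AM AV] := sA.
(* f0 only separates cosets: choosing one element in each coset makes it
   constant on them. *)
pose c x := f0 (xget 1 (left_coset x A)).
have cP x : A (x^-1 * xget 1 (left_coset x A)).
  have : left_coset x A x by exists 1; rewrite ?mulg1.
  by move=> /(@xgetI _ 1 _ x)[a Aa <-]; rewrite mulKg.
have cE x y : c x = c y <-> A (x^-1 * y).
  split=> [/f0P Axy | /(left_coset_eq _ _ sA) e]; last by rewrite /c e.
  have := AM _ _ (AM _ _ (cP x) Axy) (AV _ (cP y)).
  by rewrite invgM invgK !mulgA !mulgK.
pose T := {t : T0 | `[< exists x, c x = t >]}.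
have cT x : `[< exists y, c y = c x >] by apply/asboolP; exists x.
pose r (t : T) := xget 1 [set x | c x = val t].
exists T, (fun x => exist _ (c x) (cT x)), r; split.
  move=> t; apply: val_inj => /=; have /asboolP[x cx] := valP t.
  exact: (@xgetI _ 1 [set x | c x = val t] x).
move=> x y; split=> [[/cE] // | Axy]; apply: val_inj; exact/cE.
Qed.

(** Gam acts on the finite set of cosets of A, and the stabilizer of the coset A
    is A. The inverse in x^-1 makes the action a right one, as required by the
    order of composition in {perm T}. *)
Lemma coset_action A : subgroup A -> finite_index A ->
  exists (gT : finGroupType) (r : Gam -> gT),
    {morph r : x y / x * y} /\ forall x, r x = 1 -> A x.
Proof.
move=> sA /(finite_index_cosets sA)[T [f [r [rK fE]]]].
have [A1 AM AV] := sA.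
have injp x : injective (fun t => f (x^-1 * r t)).
  move=> t u /fE; rewrite invgM invgK mulgA mulgK => /fE.
  by rewrite !rK.
have frE x y : f (x * r (f y)) = f (x * y).
  by apply/fE; rewrite invgM mulgA mulgKV; apply/fE; rewrite rK.
exists {perm T}, (fun x => perm (injp x)); split.
  by move=> x y; apply/permP => t; rewrite permM !permE invgM frE mulgA.
move=> x /permP/(_ (f 1)); rewrite permE perm1 frE mulg1 => /fE.
by rewrite invgK mulg1.
Qed.

(** K is the kernel of the action on the cosets of A. *)
Lemma finite_index_core A : subgroup A -> finite_index A ->
  exists K, [/\ subgroup K, finite_index K, normal_in K setT & K `<=` A].
Proof.
move=> sA /(coset_action sA)[gT [r [rM rA]]].
have rM' x y : setT x -> setT y -> r (x * y) = r x * r y by [].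
have sT := subgroupT Gam.
have r1 := hom1 sT rM'; have rV x : r x^-1 = (r x)^-1 by apply: homV sT rM' _ _.
have sK : subgroup [set x | r x = 1].
  split=> //= [x y | x]; first by rewrite rM => -> ->; rewrite mulg1.
  by rewrite rV => ->; rewrite invg1.
exists [set x | r x = 1]; split=> //.
  apply/(finite_indexP sK); exists gT, r => x y /= e.
  by rewrite rM rV e mulVg.
split=> // x y _ /= ry; by rewrite (homJ sT rM') // ry conj1g.
Qed.

(** The correspondence theorem: P / N is M, and the third isomorphism theorem
    identifies H / P with G / M. *)
Lemma qmap_preim H N (gT : finGroupType) (G M : {group gT}) g :
    quotient_map H N G g -> M <| G ->
  let P := [set x | H x /\ g x \in M] in
  quotient_map H P (G / M)%G (coset M \o g) /\ quotient_map P N M g.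
Proof.
move=> gP /andP[MG nMG] P; have sH := qmap_sub gP; have [H1 HM HV] := sH.
have gM := qmapM gP.
have nM x : H x -> g x \in 'N(M).
  by move=> Hx; apply: (fintype.subsetP nMG); apply: qmap_in gP _ Hx.
have qP : quotient_map H P (G / M)%G (coset M \o g).
  split=> //.
  - by move=> x [].
  - by move=> x y Hx Hy /=; rewrite gM // morphM // nM.
  - move=> t; split=> [/morphimP[_ _ /(qmap_im gP)[x Hx <-] ->] | [x Hx <-]].
      by exists x.
    by apply: mem_morphim; [apply: nM | apply: qmap_in gP _ Hx].
  - move=> x Hx /=; split=> [/coset_idr gxM | [_ /coset_id //]].
    by split=> //; apply/gxM/nM.
split=> //; split.
- exact: qmap_ker_subgroup qP.
- move=> x Nx; have Hx := qmap_le gP Nx.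
  by split=> //; rewrite (qmap_ker gP Hx).2.
- by move=> x y [Hx _] [Hy _]; apply: gM.
- move=> t; split=> [Mt | [x [Hx gx] <-] //].
  have /(qmap_im gP)[x Hx gx] := fintype.subsetP MG _ Mt.
  by exists x => //; split=> //; rewrite gx.
- by move=> x [Hx _]; apply: (qmap_ker gP).
Qed.

(** A finite action r of Gam with kernel inside N maps H and N to finite groups I
    and J with J normal in I, and H / N is I / J since ker r is inside N. *)
Lemma finite_index_qmap H N : subgroup H -> subgroup N -> normal_in N H ->
    finite_index N ->
  exists (gT : finGroupType) (G : {group gT}) (g : Gam -> gT), quotient_map H N G g.
Proof.
move=> sH sN [NH nN] /(coset_action sN)[gT [r [rM rN]]].
have HM x y : H x -> H y -> r (x * y) = r x * r y by [].
have NM x y : N x -> N y -> r (x * y) = r x * r y by [].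
have [I IP] := hom_image_group sH HM.
have [J JP] := hom_image_group sN NM.
have rP : quotient_map H [set x | H x /\ r x = 1] I r.
  by split=> // [x [] | x Hx] //; split=> [| []].
have nJ : J <| I.
  apply/andP; split.
    by apply/fintype.subsetP => _ /JP[x Nx <-]; apply/IP; exists x => //; apply: NH.
  apply/fintype.subsetP => _ /IP[x Hx <-]; rewrite inE.
  apply/fintype.subsetP => _ /imsetP[_ /JP[y Ny <-] ->]; apply/JP.
  by exists (y ^ x); [apply: nN | rewrite (homJ sH HM) //; apply: NH].
have [qP _] := qmap_preim rP nJ.
exists (coset_of J), (I / J)%G, (coset J \o r).
suff -> : N = [set x | H x /\ r x \in J] by [].
apply/seteqP; split=> x /= => [Nx | [Hx]].
  by split; [apply: NH | apply/JP; exists x].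
move=> /JP[y Ny ryx]; rewrite -(mulgKV y x).
have [N1 NMul _] := sN; apply: NMul => //; apply: rN.
rewrite HM //; last by case: sH => _ _; apply; apply: NH.
by rewrite (homV sH HM) -?ryx ?mulgV //; apply: NH.
Qed.

End FiniteIndex.

(** * Composition series and the Jordan-Hoelder theorem *)

Section CompositionChains.
Local Open Scope classical_set_scope.
Local Open Scope group_scope.

Variable Gam : groupType.
Implicit Types (A B C H K M N : set Gam) (x y z : Gam) (S : FS) (s t : seq FS).

Definition fs_group S := tagged (val (FS_repr S)).

Definition has_factor H N S : Prop := exists g, quotient_map H N (fs_group S) g.

Lemma fs_group_simple S : simple (fs_group S).
Proof. exact: (valP (FS_repr S)). Qed.

Lemma has_factor_unique H N S S' :
  has_factor H N S -> has_factor H N S' -> S = S'.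
Proof.
move=> [g gP] [h hP]; rewrite -[S]FS_reprK -[S']FS_reprK.
by apply/FS_piP; apply: qmap_unique gP hP.
Qed.

Lemma has_factor_exists H N (gT : finGroupType) (G : {group gT}) g :
  quotient_map H N G g -> simple G -> exists S, has_factor H N S.
Proof.
move=> gP /FS_class_unique[S [GS _]]; exists S; exact: qmap_isog gP GS.
Qed.

Lemma has_factor_proper H N S : has_factor H N S -> ~ (H `<=` N).
Proof.
move=> [g gP] HN; have /simpleP[/eqP ntS _] := fs_group_simple S.
apply: ntS; apply/trivgP/fintype.subsetP => t.
by move=> /(qmap_im gP)[x Hx <-]; apply/set1gP/(qmap_ker gP) => //; apply: HN.
Qed.

(** Composition series from A to H, remembering only the list of the classes of
    their factors: concatenation of series is then concatenation of lists, and
    independence of the series is equality of lists up to permutation. *)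
Inductive comp_chain A : set Gam -> seq FS -> Prop :=
| comp_chain_nil : subgroup A -> comp_chain A A [::]
| comp_chain_cons H N S s :
    has_factor H N S -> comp_chain A N s -> comp_chain A H (S :: s).

Inductive subnormal_in A : set Gam -> Prop :=
| subnormal_in_refl : subgroup A -> subnormal_in A A
| subnormal_in_cons H N :
    subgroup H -> normal_in N H -> subnormal_in A N -> subnormal_in A H.

Lemma subnormal_in_le A H : subnormal_in A H ->
  [/\ subgroup A, subgroup H & A `<=` H].
Proof.
elim=> [sA | {}H N sH [NH _] _ [sA sN AN]]; split=> // x /AN; exact: NH.
Qed.

Lemma subnormal_in_trans A B C :
  subnormal_in A B -> subnormal_in B C -> subnormal_in A C.
Proof. by move=> snA; elim=> // H N sH nN _; apply: subnormal_in_cons. Qed.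

Lemma subnormal_in_cap A H M : subgroup M -> subnormal_in A H ->
  subnormal_in (A `&` M) (H `&` M).
Proof.
move=> sM; elim=> [sA | {}H N sH [NH nN] _ IH].
  by apply: subnormal_in_refl; apply: subgroupI.
apply: subnormal_in_cons IH; first exact: subgroupI.
split=> [x [/NH] // | x y [Hx Mx] [Ny My]]; split; first exact: nN.
exact: subgroup_conj.
Qed.

Lemma subnormal_in_between A H M : subgroup M -> A `<=` M -> M `<=` H ->
  subnormal_in A H -> subnormal_in A M.
Proof.
move=> sM AM MH /(subnormal_in_cap sM).
by rewrite (setIidl AM) (setIidr MH).
Qed.

Lemma comp_chain_subnormal A H s : comp_chain A H s -> subnormal_in A H.
Proof.
elim=> [|{}H N S {}s [g gP] _]; first exact: subnormal_in_refl.
by apply: subnormal_in_cons (qmap_ker_normal gP); apply: qmap_sub gP.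
Qed.

Lemma comp_chain_cat A B H s t :
  comp_chain B H s -> comp_chain A B t -> comp_chain A H (s ++ t).
Proof. by elim=> //= {}H N S {}s HN _ IH /IH; apply: comp_chain_cons. Qed.

(** Induction on the order of G, which stands for H / N: a maximal normal subgroup
    M of G gives a simple quotient G / M, and M has smaller order. *)
Lemma comp_chain_qmap n H N (gT : finGroupType) (G : {group gT}) g :
  (#|G| <= n)%N -> quotient_map H N G g -> exists s, comp_chain N H s.
Proof.
elim: n H G => [|n IH] H G; first by rewrite leqNgt cardG_gt0.
move=> leGn gP; have [G1 | ntG] := eqVneq (G : {set gT}) 1%g.
  exists [::]; suff -> : H = N by apply: comp_chain_nil; apply: qmap_ker_subgroup gP.
  apply/seteqP; split; last exact: qmap_le gP.
  by move=> x Hx; apply/(qmap_ker gP) => //; apply/set1gP; rewrite -G1 (qmap_in gP).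
have [M maxM] := ex_maxnormal_ntrivg ntG.
have nM := maxnormal_normal maxM.
have simGM : simple (G / M)%G by rewrite quotient_simple.
have [qP /IH] := qmap_preim gP nM.
case=> [|s sP].
  by rewrite -ltnS; apply: leq_trans leGn; apply: proper_card (maxnormal_proper maxM).
have [S HS] := has_factor_exists qP simGM.
by exists (S :: s); apply: comp_chain_cons sP.
Qed.

Lemma comp_chain_exists A H : subnormal_in A H -> finite_index A ->
  exists s, comp_chain A H s.
Proof.
move=> + fA; elim=> [sA | {}H N sH nN snA [s sP]].
  by exists [::]; apply: comp_chain_nil.
have [sA sN AN] := subnormal_in_le snA.
have fN := finite_index_le sA sN AN fA.
have [gT [G [g gP]]] := finite_index_qmap sH sN nN fN.
have [t tP] := comp_chain_qmap (leqnn _) gP.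
by exists (t ++ s); apply: comp_chain_cat sP.
Qed.

Lemma has_factor_diamond H N K S S' :
  has_factor H N S -> has_factor H K S' -> N <> K -> has_factor N (N `&` K) S'.
Proof.
move=> [g gP] [h hP] neNK; exists h.
exact: qmap_capl gP hP (fs_group_simple S) (fs_group_simple S') neNK.
Qed.

(** Jordan-Hoelder. Induction on the length of s; when the first terms N and K
    of the two series differ, a series u from A to N :&: K extends to series
    S' :: u from A to N and S :: u from A to K. Comparing S' :: u
    with the tail of s shows that S :: u is as short as this tail, so that the
    induction hypothesis also applies to S :: u and the tail of t. *)
Theorem comp_chain_perm A H s t : finite_index A ->
  comp_chain A H s -> comp_chain A H t -> perm_eq s t.
Proof.
move=> fA; have [n] := ubnP (size s); elim: n s t H => // n IH s t H.
have nilP K u : comp_chain A K u -> K = A -> u = [::].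
  case=> // {}K N S {}u KN /comp_chain_subnormal/subnormal_in_le[_ _ AN] KA.
  by case: (has_factor_proper KN); rewrite KA.
move=> + sP; case: sP => [_ _ /nilP -> // | {}H N S {}s HN sP].
rewrite /= ltnS => les tP; case: tP HN => [_ HN|{}H K S' {}t HK tP HN].
  by have := nilP _ _ (comp_chain_cons HN sP) erefl.
have [eNK | neNK] := pselect (N = K).
  move: HK tP; rewrite -eNK => /(has_factor_unique HN) <- tP.
  by rewrite perm_cons; apply: IH tP.
have NKP := has_factor_diamond HN HK neNK.
have KNP : has_factor K (N `&` K) S.
  by rewrite setIC; apply: has_factor_diamond HK HN _ => /esym.
have [sA sN AN] := subnormal_in_le (comp_chain_subnormal sP).
have [_ sK AK] := subnormal_in_le (comp_chain_subnormal tP).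
have [u uP] : exists u, comp_chain A (N `&` K) u.
  apply: comp_chain_exists => //.
  apply: subnormal_in_between (comp_chain_subnormal sP); first exact: subgroupI.
    by move=> x Ax; split; [apply: AN | apply: AK].
  by move=> x [].
have su : perm_eq s (S' :: u) by apply: IH les sP (comp_chain_cons NKP uP).
have ut : perm_eq (S :: u) t.
  by apply: IH (comp_chain_cons KNP uP) tP; rewrite /= -(perm_size su : _ = (size u).+1).
apply: perm_trans (_ : perm_eq _ (S' :: S :: u)) _; last by rewrite perm_cons.
apply: perm_trans (_ : perm_eq _ (S :: S' :: u)) _; first by rewrite perm_cons.
exact: (permEl (perm_catCA [:: S] [:: S'] u)).
Qed.

End CompositionChains.

(** * The numbers n_S(A) *)

Section FactorCounts.
Local Open Scope classical_set_scope.
Local Open Scope group_scope.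

Variable Gam : groupType.
Implicit Types (A B C H K M N : set Gam) (x y z : Gam) (S : FS) (s t : seq FS).
Implicit Types (T : nat -> set Gam).

(** Series that start at an arbitrary subgroup H, so that inductions can remove the
    first term. *)
Definition series_from (step : set Gam -> set Gam -> Prop) H A
    (l : nat) T : Prop :=
  [/\ T 0 = H, T l = A, forall i, (i <= l)%N -> subgroup (T i)
    & forall i, (i < l)%N -> step (T i) (T i.+1)].

Lemma series_from_behead step H A l T : series_from step H A l.+1 T ->
  series_from step (T 1%N) A l (fun i => T i.+1).
Proof. by case=> _ Tl sT Tstep; split=> // i ltil; [apply: sT | apply: Tstep]. Qed.

Lemma series_from_cons step H N A l T : subgroup H -> step H N ->
  series_from step N A l T ->
  series_from step H A l.+1 (fun i => if i is j.+1 then T j else H).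
Proof.
by move=> sH HN [T0 Tl sT Tstep]; split=> // -[|i] //=; [apply: sT | rewrite T0 | apply: Tstep].
Qed.

Lemma subnormalP A : subnormal A <-> subnormal_in A setT.
Proof.
split=> [[l [T TP]] | ].
  have {TP} : series_from (fun M N => normal_in N M) setT A l T by [].
  elim: l T setT => [|l IH] T H TP.
    by have [<- <- sT _] := TP; apply: subnormal_in_refl; apply: sT.
  have [<- _ sT Tstep] := TP.
  apply: subnormal_in_cons (IH _ _ (series_from_behead TP)); first exact: sT.
  exact: Tstep.
suff sn_series H : subnormal_in A H ->
    exists l T, series_from (fun M N => normal_in N M) H A l T.
  by move=> /sn_series.
elim=> [sA | {}H N sH nN _ [l [T TP]]]; first by exists 0, (fun=> A).
by exists l.+1; eexists; apply: (series_from_cons sH _ TP).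
Qed.

Lemma factor_classP H N S : subgroup H -> subgroup N -> normal_in N H ->
  factor_class H N S <-> has_factor H N S.
Proof. exact: quotient_isogP. Qed.

Lemma nb_factors_recl S l T :
  nb_factors S l.+1 T
  = (`[< factor_class (T 0) (T 1%N) S >] + nb_factors S l (fun i => T i.+1))%N.
Proof.
have nbE k U : nb_factors S k U = (\sum_(i < k) `[< factor_class (U i) (U i.+1) S >])%N.
  rewrite /nb_factors cardsE -sum1_card big_mkcond /=.
  by apply: eq_bigr => i _; rewrite -[_ \in _]/(asbool _); case: asbool.
by rewrite !nbE big_ord_recl.
Qed.

Lemma comp_series_chain A l T : comp_series A l T ->
  exists2 s, comp_chain A setT s & forall S, nb_factors S l T = count_mem S s.
Proof.
move=> TP; have {TP} : series_from
  (fun M N => normal_in N M /\ quotient_finite_simple M N) setT A l T by [].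
elim: l T setT => [|l IH] T H TP.
  have [<- <- sT _] := TP; exists [::]; first exact/comp_chain_nil/sT.
  by move=> S; apply/eqP; rewrite cards_eq0; apply/eqP/setP => -[].
have [s sP sE] := IH _ _ (series_from_behead TP).
have [T0 _ sT Tstep] := TP; have [nT [gT [G [simG QG]]]] := Tstep 0 isT.
have sTS : forall i, (i <= 1)%N -> subgroup (T i) by case=> [|[]] // _; apply: sT.
have [g gP] := (quotient_isogP _ (sTS 0 isT) (sTS 1%N isT) nT).1 QG.
have [S HS] := has_factor_exists gP simG.
exists (S :: s); first by rewrite -T0; apply: comp_chain_cons sP.
move=> S'; rewrite nb_factors_recl sE /=; congr (_ + _)%N; congr nat_of_bool.
apply/asboolP/eqP => [/(factor_classP _ (sTS 0 isT) (sTS 1%N isT) nT) | <-].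
  exact: has_factor_unique.
exact/(factor_classP _ (sTS 0 isT) (sTS 1%N isT) nT).
Qed.

Lemma comp_chain_series A s : comp_chain A setT s -> exists l T, comp_series A l T.
Proof.
suff chain_series H : comp_chain A H s -> exists l T,
    series_from (fun M N => normal_in N M /\ quotient_finite_simple M N) H A l T.
  exact: chain_series.
elim=> [sA | {}H N S {}s HN sP [l [T TP]]]; first by exists 0, (fun=> A).
have [g gP] := HN; have sH := qmap_sub gP; have nN := qmap_ker_normal gP.
exists l.+1; eexists; apply: (series_from_cons sH _ TP); split=> //.
exists _, (fs_group S); split; first exact: fs_group_simple.
exact/(factor_classP _ sH (qmap_ker_subgroup gP) nN).
Qed.

Lemma n_comp_chain A s S : finite_index A -> comp_chain A setT s ->
  n_ S A = count_mem S s.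
Proof.
move=> fA sP; have [l [T TP]] := comp_chain_series sP.
have : [set k | exists l T, comp_series A l T /\ k = nb_factors S l T] (nb_factors S l T).
  by exists l, T.
move=> /(@xgetI _ 0); rewrite -/(n_ S A) => -[l' [T' [/comp_series_chain[t tP tE] ->]]].
by rewrite tE; apply/seq.permP; apply: comp_chain_perm fA tP sP.
Qed.

Lemma n_chain_exists A : subgroup A -> finite_index A -> subnormal A ->
  exists2 s, comp_chain A setT s & forall S, n_ S A = count_mem S s.
Proof.
move=> sA fA /subnormalP/comp_chain_exists/(_ fA)[s sP].
by exists s => // S; apply: n_comp_chain.
Qed.

End FactorCounts.

(** * Virtual isomorphisms and the map d *)

Section Commensurations.
Import GRing.Theory.
Local Open Scope classical_set_scope.
Local Open Scope group_scope.

Variable Gam : groupType.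
Implicit Types (A B C H K M N : set Gam) (x y z : Gam) (S : FS) (s t : seq FS).
Implicit Types (phi psi : virt_iso Gam).

Section Image.
Variable phi : virt_iso Gam.

Lemma subgroup_image H : subgroup H -> H `<=` vdom phi -> subgroup (phi @` H).
Proof.
by move=> sH HA; rewrite vimageE //; apply: (@vpreim_subgroup _ (vinv phi)).
Qed.

Lemma finite_index_image H : subgroup H -> finite_index H -> H `<=` vdom phi ->
  finite_index (phi @` H).
Proof.
by move=> sH fH HA; rewrite vimageE //; apply: (@vpreim_finite_index _ (vinv phi)).
Qed.

Lemma vfunJ x y : vdom phi x -> vdom phi y -> phi (y ^ x) = phi y ^ phi x.
Proof.
move=> Ax Ay; have [A1 AM AV] := vdom_subgroup phi.
apply: (@mulgI _ (phi x)); rewrite -vfunM //.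
  by rewrite !conjgE !mulgA !mulgV !mul1g vfunM.
exact: subgroup_conj (vdom_subgroup phi) _ _.
Qed.

Lemma normal_in_image N H : H `<=` vdom phi -> normal_in N H ->
  normal_in (phi @` N) (phi @` H).
Proof.
move=> HA [NH nN]; split; first exact: image_subset.
move=> _ _ [x Hx <-] [y Ny <-]; exists (y ^ x); first exact: nN.
by rewrite vfunJ //; [apply: HA | apply/HA/NH].
Qed.

Lemma has_factor_image N H S : H `<=` vdom phi -> has_factor H N S ->
  has_factor (phi @` H) (phi @` N) S.
Proof.
move=> HA [g gP]; exists (g \o vinv_fun phi).
have NH := qmap_le gP; have sH := qmap_sub gP; have [_ HM _] := sH.
have phiK x : H x -> vinv_fun phi (phi x) = x by move=> /HA/vinv_funK.
split.
- exact: subgroup_image.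
- exact: image_subset.
- move=> _ _ [x Hx <-] [y Hy <-] /=; rewrite -vfunM; try exact: HA.
  by rewrite !phiK ?(qmapM gP) //; apply: HM.
- move=> t; rewrite (qmap_im gP); split=> [[x Hx <-] | [_ [x Hx <-] <-]].
    by exists (phi x); [exists x | rewrite /= phiK].
  by exists x => //=; rewrite phiK.
- move=> _ [x Hx <-] /=; rewrite phiK // (qmap_ker gP) //.
  split=> [Nx | [y Ny /vfun_inj <- //]]; [by exists x | by apply/HA/NH | exact: HA].
Qed.

Lemma subnormal_in_image A H : H `<=` vdom phi -> subnormal_in A H ->
  subnormal_in (phi @` A) (phi @` H).
Proof.
move=> + snH; elim: snH => [sA AA | {}H N sH nN _ IH HA].
  by apply: subnormal_in_refl; apply: subgroup_image.
apply: subnormal_in_cons (normal_in_image HA nN) _; first exact: subgroup_image.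
by apply: IH => x /(nN.1)/HA.
Qed.

Lemma comp_chain_image A H s : H `<=` vdom phi -> comp_chain A H s ->
  comp_chain (phi @` A) (phi @` H) s.
Proof.
move=> + sP; elim: sP => [sA AA | {}H N S {}s HN _ IH HA].
  by apply: comp_chain_nil; apply: subgroup_image.
apply: comp_chain_cons (has_factor_image HA HN) _.
by apply: IH => x Nx; apply: HA; have [g /qmap_le] := HN; apply.
Qed.

Lemma image_vdom : phi @` vdom phi = vcod phi.
Proof.
apply/seteqP; split=> [_ [x Ax <-] | y /vfun_surj[x Ax <-]]; first exact: vfun_cod.
by exists x.
Qed.

End Image.

Lemma subnormal_image phi C : subnormal (vcod phi) -> C `<=` vdom phi ->
  subnormal_in C (vdom phi) -> subnormal (phi @` C).
Proof.
move=> /subnormalP snB CA snC; apply/subnormalP; apply: subnormal_in_trans snB.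
by rewrite -image_vdom; apply: subnormal_in_image.
Qed.

Definition n_diff phi S : int := ((n_ S (vcod phi))%:Z - (n_ S (vdom phi))%:Z)%R.

(** The factors between C and vdom phi are, through phi, also those between phi(C)
    and vcod phi, so they cancel in the difference. *)
Lemma n_diff_restrict phi C S : subnormal_iso phi ->
    subgroup C -> finite_index C -> subnormal C -> C `<=` vdom phi ->
  n_diff phi S = ((n_ S (phi @` C))%:Z - (n_ S C)%:Z)%R.
Proof.
move=> [snA snB] sC fC /subnormalP snC CA.
have [sA sB] := (vdom_subgroup phi, vcod_subgroup phi).
have snCA := subnormal_in_between sA CA (fun _ _ => I) snC.
have [s sP] := comp_chain_exists snCA fC.
have [sa saP saE] := n_chain_exists sA (vdom_finite_index phi) snA.
have [sb sbP sbE] := n_chain_exists sB (vcod_finite_index phi) snB.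
have imP : comp_chain (phi @` C) (vcod phi) s.
  by rewrite -image_vdom; apply: comp_chain_image.
rewrite /n_diff saE sbE (n_comp_chain S fC (comp_chain_cat saP sP)).
rewrite (n_comp_chain S (finite_index_image sC fC CA) (comp_chain_cat sbP imP)).
by rewrite !count_cat !PoszD opprD addrACA subrr addr0.
Qed.

(** The core K of a subgroup where phi and psi agree is subnormal, and phi(K) is
    psi(K). *)
Lemma n_diff_virt_eq phi psi S : subnormal_iso phi -> subnormal_iso psi ->
  virt_eq phi psi -> n_diff phi S = n_diff psi S.
Proof.
move=> snphi snpsi [C [sC fC CAA eqC]].
have [K [sK fK nK KC]] := finite_index_core sC fC.
have snK : subnormal K.
  apply/subnormalP; apply: subnormal_in_cons nK _; first exact: subgroupT.
  exact: subnormal_in_refl.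
rewrite (n_diff_restrict S snphi sK fK snK); last by move=> x /KC/CAA[].
rewrite (n_diff_restrict S snpsi sK fK snK); last by move=> x /KC/CAA[].
suff -> : phi @` K = psi @` K by [].
by apply/seteqP; split=> _ [x Kx <-]; exists x => //; rewrite eqC //; apply: KC.
Qed.

Lemma vinv_subnormal phi : subnormal_iso phi -> subnormal_iso (vinv phi).
Proof. by case. Qed.

Lemma vcomp_domE phi psi :
  vcomp_dom phi psi = vinv phi @` (vcod phi `&` vdom psi).
Proof.
apply/seteqP; split=> [x [Ax BCx] | _ [y [By Cy] <-]].
  by exists (phi x) => //; apply: vinv_funK.
by have [Ay fy] := vinv_funP By; split=> //=; rewrite fy.
Qed.

(** Put C = vdom psi and let E be its intersection with vcod phi. Intersecting
    with C a subnormal series from vcod phi to Gam gives one from E to C, and C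
    is subnormal, so E is subnormal. The difference of phi is computed on E
    through the inverse of phi, which maps E onto the domain of the composite. *)
Lemma n_diff_vcomp phi psi : subnormal_iso phi -> subnormal_iso psi ->
  subnormal_iso (vcomp phi psi) /\
  forall S, n_diff (vcomp phi psi) S = (n_diff psi S + n_diff phi S)%R.
Proof.
move=> snphi snpsi; have [snA snB] := snphi; have [snC snD] := snpsi.
set E := vcod phi `&` vdom psi.
have sE : subgroup E by apply: subgroupI; [apply: vcod_subgroup | apply: vdom_subgroup].
have fE : finite_index E.
  by apply: finite_indexI; [apply: vcod_subgroup | apply: vdom_subgroup
    | apply: vcod_finite_index | apply: vdom_finite_index].
have EB : E `<=` vcod phi by move=> x [].
have EC : E `<=` vdom psi by move=> x [].
have snE : subnormal E.
  apply/subnormalP; apply: subnormal_in_trans ((subnormalP _).1 snC).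
  rewrite -[X in subnormal_in _ X]setTI; apply: subnormal_in_cap.
    exact: vdom_subgroup.
  exact/subnormalP.
have between H : subgroup H -> E `<=` H -> subnormal_in E H.
  by move=> sH EH; apply: subnormal_in_between sH EH _ ((subnormalP _).1 snE).
split=> [|S].
  split=> /=; first rewrite vcomp_domE.
    by apply: (@subnormal_image (vinv phi) _ snA) => //; apply: between (vcod_subgroup _) EB.
  by apply: subnormal_image => //; apply: between (vdom_subgroup _) EC.
rewrite (n_diff_restrict S snpsi sE fE snE EC).
have -> : n_diff phi S = (- n_diff (vinv phi) S)%R by rewrite /n_diff opprB.
rewrite (n_diff_restrict S (vinv_subnormal snphi) sE fE snE EB) -vcomp_domE.
by rewrite /n_diff /= /vcomp_cod -/E opprB addrA subrK.
Qed.

Lemma vrestrict_bij phi C (CA : C `<=` vdom phi) : set_bij C (phi @` C) phi.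
Proof.
split; first by move=> x Cx; exists x.
  by move=> x y /set_mem/CA Ax /set_mem/CA Ay; apply: vfun_inj.
by move=> _ [x Cx <-]; exists x.
Qed.

Lemma vrestrict_exists phi C : subgroup C -> finite_index C -> C `<=` vdom phi ->
  exists psi, [/\ vdom psi = C, vcod psi = phi @` C & virt_eq psi phi].
Proof.
move=> sC fC CA.
have CM x y : C x -> C y -> phi (x * y) = phi x * phi y.
  by move=> /CA Ax /CA Ay; apply: vfunM.
exists (VirtIso sC (subgroup_image sC CA) fC (finite_index_image sC fC CA)
  (vrestrict_bij CA) CM).
by split=> //; exists C; split=> // x Cx; split=> //; apply: CA.
Qed.

Lemma normal_in_subnormal C H : subgroup C -> subgroup H -> normal_in C H ->
  subnormal_in C H.
Proof.
by move=> sC sH nC; apply: subnormal_in_cons nC _ => //; apply: subnormal_in_refl.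
Qed.

(** The core of vdom phi would not do: its image is normal in vcod phi only, which
    need not be subnormal. Hence the core is taken inside the preimage of a
    subgroup L of vcod phi that is normal in Gam. *)
Lemma subnormal_repr phi : exists2 psi, subnormal_iso psi & virt_eq psi phi.
Proof.
have [sA sB] := (vdom_subgroup phi, vcod_subgroup phi).
have sT := subgroupT Gam; have fB := vcod_finite_index phi.
have [L [sL fL nL LB]] := finite_index_core sB fB.
pose P := [set x | vdom phi x /\ L (phi x)].
have sP : subgroup P by apply: vpreim_subgroup.
have fP : finite_index P by apply: vpreim_finite_index.
have [K [sK fK [_ nK] KP]] := finite_index_core sP fP.
have PA : P `<=` vdom phi by move=> x [].
have KA : K `<=` vdom phi by move=> x /KP/PA.
have [psi [domE codE eqpsi]] := vrestrict_exists sK fK KA.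
exists psi => //; split; rewrite ?domE ?codE.
  by apply/subnormalP; apply: normal_in_subnormal sK sT (conj _ nK).
have PL : phi @` P = L.
  apply/seteqP; split=> [_ [x [_ Lx] <-] // | y Ly].
  by have [x Ax fx] := vfun_surj (LB _ Ly); exists x => //; split=> //; rewrite fx.
apply/subnormalP; apply: subnormal_in_trans (normal_in_subnormal sL sT nL).
rewrite -PL; apply: subnormal_in_image => //; apply: normal_in_subnormal => //.
by split=> // x y _; apply: nK.
Qed.

Definition factor_sum A : {freeg FS} :=
  (\sum_(S <- xget [::] [set s | comp_chain A setT s]) << 1 *g S >>)%R.

Lemma coeff_factor_sum A S : subgroup A -> finite_index A -> subnormal A ->
  coeff S (factor_sum A) = (n_ S A)%:Z%R.
Proof.
move=> sA fA snA; have [s sP _] := n_chain_exists sA fA snA.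
rewrite /factor_sum; have := @xgetI _ [::] [set s | comp_chain A setT s] s sP.
move: (xget _ _) => t tP; rewrite (n_comp_chain S fA tP).
elim: t {tP} => [|S' t IH]; first by rewrite big_nil coeff0.
by rewrite big_cons coeffD IH coeffU mul1r /= PoszD natz.
Qed.

Definition comm_diff (c : Comm Gam) : {freeg FS} :=
  let phi := xget (Comm_repr c) [set phi | subnormal_iso phi /\ Comm_class phi = c] in
  (factor_sum (vcod phi) - factor_sum (vdom phi))%R.

Lemma subnormal_class c : exists2 phi : virt_iso Gam,
  subnormal_iso phi & Comm_class phi = c.
Proof.
have [phi snphi eqphi] := subnormal_repr (Comm_repr c).
by exists phi => //; rewrite -[c]Comm_class_repr; apply/Comm_classP.
Qed.

Lemma coeff_comm_diff phi S : subnormal_iso phi ->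
  coeff S (comm_diff (Comm_class phi)) = n_diff phi S.
Proof.
move=> snphi; rewrite /comm_diff.
have := @xgetI _ (Comm_repr (Comm_class phi))
  [set psi | subnormal_iso psi /\ Comm_class psi = Comm_class phi] phi.
move: (xget _ _) => psi [] // snpsi /Comm_classP eqpsi.
rewrite -(n_diff_virt_eq S snpsi snphi eqpsi) coeffB; have [snA snB] := snpsi.
rewrite !coeff_factor_sum //; try exact: vdom_subgroup; try exact: vcod_subgroup.
  exact: vdom_finite_index.
exact: vcod_finite_index.
Qed.

Lemma comm_diffM (c1 c2 : Comm Gam) :
  comm_diff (c1 * c2) = (comm_diff c1 + comm_diff c2)%R.
Proof.
have [psi snpsi <-] := subnormal_class c1; have [phi snphi <-] := subnormal_class c2.
have [snc cE] := n_diff_vcomp snphi snpsi.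
have -> : Comm_class psi * Comm_class phi = Comm_class (vcomp phi psi).
  exact: Comm_mulE.
by apply/eqP/freeg_eqP => S; rewrite coeffD !coeff_comm_diff.
Qed.

End Commensurations.

Theorem theorem2p6 (Gam : groupType) :
  (* n_ S A is computed by every composition series from A to Gam *)
  (forall A : set Gam, subgroup A -> finite_index A -> subnormal A ->
     (exists l T, comp_series A l T) /\
     (forall l T, comp_series A l T -> forall S, nb_factors S l T = n_ S A)) /\
  (forall c : Comm Gam,
     exists2 phi : virt_iso Gam, subnormal_iso phi & Comm_class phi = c) /\
  exists d : Comm Gam -> {freeg FS},
    (forall phi : virt_iso Gam, subnormal_iso phi ->
       forall S : FS,
         coeff S (d (Comm_class phi))
         = ((n_ S (vcod phi))%:Z - (n_ S (vdom phi))%:Z)%R) /\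
    (forall c1 c2 : Comm Gam, d (c1 * c2)%g = (d c1 + d c2)%R).
Proof.
split; [move=> A sA fA snA | split; first exact: subnormal_class].
  have [s sP _] := n_chain_exists sA fA snA.
  split=> [|l T /comp_series_chain[t tP tE] S]; first exact: comp_chain_series sP.
  by rewrite tE (n_comp_chain S fA tP).
exists (@comm_diff Gam); split; last exact: comm_diffM.
by move=> phi snphi S; apply: coeff_comm_diff.
Qed.
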